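(* Let $X$ be a separable Banach space that is an effective Banach space, and let $T$ be an effective linear operator on $X_k$. Then $T$ has a unique continuous linear extension to all of $X$.
   Context: An effective Banach space is a Banach space with a Pour-El–Richards computability structure (set of ''computable sequences'' closed under computable linear combinations and effective limits, whose norms are computable real sequences) admitting a computable sequence $(e_n)$ with dense linear span; $X_k$ is the set of computable elements. With $(a_n)$ a computable enumeration of the rational span of $(e_n)$, the standard numbering $\alpha$ is: $e\in\operatorname{dom}\alpha$ iff $\varphi_e$ is total and $\|a_{\varphi_e(n)}-\lim_m a_{\varphi_e(m)}\|<2^{-n}$ for all $n$, $\alpha e=\lim_m a_{\varphi_e(m)}$. $T$ is effective if there is a partial recursive $\psi$ with $T(\alpha e)=\alpha\psi(e)$ for all $e\in\operatorname{dom}\alpha$. *)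

(* Defs.v *)
From HB Require Import structures.
From mathcomp Require Import all_boot all_order all_algebra.
From mathcomp Require Import complex.
From mathcomp Require Import all_classical all_reals all_analysis.

Set Implicit Arguments.
Unset Strict Implicit.
Unset Printing Implicit Defensive.

Import Order.TTheory GRing.Theory Num.Theory.
Import numFieldNormedType.Exports.

Local Open Scope classical_set_scope.
Local Open Scope ring_scope.

(** * Partial recursive functions *)

Inductive recfun : nat -> Type :=
| RZero k : recfun k
| RSucc : recfun 1
| RProj k (i : 'I_k) : recfun k
| RComp k m (f : recfun m) (g : 'I_m -> recfun k) : recfun k
| RPrec k (f : recfun k) (g : recfun k.+2) : recfun k.+1
| RMu k (f : recfun k.+1) : recfun k.

(* [rf_eval c v y] : the computation of [c] on [v] halts with value [y].
   In [RPrec], [h] is the course of values h(0) = f(w), h(i+1) = g(i, h(i), w);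
   in [RMu], all values before the first zero must be defined. *)
Fixpoint rf_eval (k : nat) (c : recfun k) : k.-tuple nat -> nat -> Prop :=
  match c in recfun k return k.-tuple nat -> nat -> Prop with
  | RZero _ => fun _ y => y = 0%N
  | RSucc => fun v y => y = (thead v).+1
  | RProj _ i => fun v y => y = tnth v i
  | RComp _ m f g => fun v y =>
      exists w : m.-tuple nat,
        (forall i, rf_eval (g i) v (tnth w i)) /\ rf_eval f w y
  | RPrec k f g => fun v y =>
      let w : k.-tuple nat := behead_tuple v in
      exists h : nat -> nat,
        [/\ rf_eval f w (h 0%N),
            forall i, (i < thead v)%N ->
              rf_eval g [tuple of i :: h i :: w] (h i.+1)
          & y = h (thead v)]
  | RMu _ f => fun v y =>
      rf_eval f [tuple of y :: v] 0%N /\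
      forall i, (i < y)%N -> exists z, rf_eval f [tuple of i :: v] z.+1
  end.

(* Partial functions are [option]-valued; [None] means undefined. *)
Definition partial_recursive (k : nat) (F : k.-tuple nat -> option nat) : Prop :=
  exists c : recfun k, forall v y, F v = Some y <-> rf_eval c v y.

Definition partial_recursive1 (f : nat -> option nat) : Prop :=
  partial_recursive (fun v : 1.-tuple nat => f [tnth v 0]).

Definition partial_recursive2 (f : nat -> nat -> option nat) : Prop :=
  partial_recursive (fun v : 2.-tuple nat => f [tnth v 0] [tnth v 1]).

Definition recursive1 (f : nat -> nat) : Prop :=
  partial_recursive1 (fun x => Some (f x)).

Definition recursive2 (f : nat -> nat -> nat) : Prop :=
  partial_recursive2 (fun x y => Some (f x y)).

(* Acceptable (Goedel) numberings in the sense of Rogers: the universal function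
   is partial recursive and the s-m-n property holds.  The latter, applied to
   functions not depending on their first argument, shows that every unary
   partial recursive function is some [phi e]. *)
Definition acceptable_numbering (phi : nat -> nat -> option nat) : Prop :=
  partial_recursive2 phi /\
  forall F : nat -> nat -> option nat, partial_recursive2 F ->
    exists2 s : nat -> nat, recursive1 s & forall x y, phi (s x) y = F x y.

(* Cantor's pairing bijection. *)
Definition cpair (n k : nat) : nat := (((n + k) * (n + k).+1)./2 + k)%N.

(* The double sequences that, re-enumerated along [cpair], lie in [S]. *)
Definition double_seq (T : Type) (S : set (nat -> T)) : set (nat -> nat -> T) :=
  [set u | exists2 x, S x & forall n k, u n k = x (cpair n k)].

(** * Computable scalars *)

(* Banach spaces may be real ([cplx = false]) or complex ([cplx = true]). *)
Definition scalars (R : realType) (cplx : bool) : numFieldType :=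
  if cplx then (R[i] : numFieldType) else (R : numFieldType).

(* The imaginary unit in the complex case; the dummy value 0 in the real case,
   so that {p + q i} is Q(i) resp. Q when p, q range over the rationals. *)
Definition im_unit (R : realType) (cplx : bool) : scalars R cplx :=
  match cplx return scalars R cplx with
  | true => ('i : R[i])
  | false => (0 : R)
  end.

Definition computable_rat_seq2 (K : numFieldType) (r : nat -> nat -> K) : Prop :=
  exists s p q : nat -> nat -> nat,
    [/\ recursive2 s, recursive2 p, recursive2 q &
        forall n k, q n k != 0%N /\
          r n k = (-1) ^+ s n k * (p n k)%:R / (q n k)%:R].

(* Computable sequences of real numbers (inside [K], which may be complex). *)
Definition computable_real_seq (K : numFieldType) (x : nat -> K) : Prop :=
  exists2 r : nat -> nat -> K, computable_rat_seq2 r &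
    forall n k, `|x n - r n k| <= 2 ^- k.

Definition computable_scalar_seq (R : realType) (cplx : bool) :
    set (nat -> scalars R cplx) :=
  [set z | exists x y : nat -> scalars R cplx,
     [/\ computable_real_seq x, computable_real_seq y &
         forall n, z n = x n + im_unit R cplx * y n]].

Definition computable_scalar (R : realType) (cplx : bool)
    (c : scalars R cplx) : Prop :=
  @computable_scalar_seq R cplx (fun=> c).

(** * Effective Banach spaces *)

Definition separable (X : topologicalType) : Prop :=
  exists2 D : set X, countable D & dense D.

(* u n k --> x n as k --> oo, effectively in k and n. *)
Definition effective_limit (K : numFieldType) (X : normedModType K)
    (u : nat -> nat -> X) (x : nat -> X) : Prop :=
  exists2 m : nat -> nat -> nat, recursive2 m &
    forall n N k, (m n N <= k)%N -> `|u n k - x n| <= 2 ^- N.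

(* The axioms of Pour-El and Richards: linear forms, limits, norms. *)
Record computability_structure (R : realType) (cplx : bool)
    (X : completeNormedModType (scalars R cplx)) (S : set (nat -> X)) : Prop := {
  cs_linear : forall (x y : nat -> X) (c d : nat -> nat -> scalars R cplx)
      (l : nat -> nat), S x -> S y ->
    double_seq (@computable_scalar_seq R cplx) c ->
    double_seq (@computable_scalar_seq R cplx) d ->
    recursive1 l ->
    S (fun n => \sum_(k < (l n).+1) (c n k *: x k + d n k *: y k));
  cs_limit : forall (u : nat -> nat -> X) (x : nat -> X),
    double_seq S u -> effective_limit u x -> S x;
  cs_norm : forall x : nat -> X, S x ->
    computable_real_seq (fun n => `|x n|)
}.

Definition lin_span (K : numFieldType) (X : normedModType K) (e : nat -> X) :
    set X :=
  [set x | exists d (c : nat -> K), x = \sum_(k < d) c k *: e k].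

(* Span over Q for real spaces, over Q(i) for complex ones. *)
Definition rational_span (R : realType) (cplx : bool)
    (X : completeNormedModType (scalars R cplx)) (e : nat -> X) : set X :=
  [set x | exists d (p q : nat -> rat),
     x = \sum_(k < d) (ratr (p k) + im_unit R cplx * ratr (q k)) *: e k].

Definition effective_generating_seq (K : numFieldType) (X : normedModType K)
    (S : set (nat -> X)) (e : nat -> X) : Prop :=
  S e /\ dense (lin_span e).

Definition computable_enum_rational_span (R : realType) (cplx : bool)
    (X : completeNormedModType (scalars R cplx)) (S : set (nat -> X))
    (e a : nat -> X) : Prop :=
  S a /\ range a = rational_span e.

Definition computable_elements (X : Type) (S : set (nat -> X)) : set X :=
  [set x | S (fun=> x)].

(* The standard numbering as a functional relation: [std_numbering phi a e x]
   says that e is in its domain and that x is the value at e. *)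
Definition std_numbering (K : numFieldType) (X : normedModType K)
    (phi : nat -> nat -> option nat) (a : nat -> X) (e : nat) (x : X) : Prop :=
  exists f : nat -> nat,
    [/\ forall n, phi e n = Some (f n),
        (a \o f) @ \oo --> x
      & forall n, `|a (f n) - x| < 2 ^- n].

(* An operator on [X_k] is given by a function [X -> X], whose values outside
   [X_k] are irrelevant.  [X_k] is a vector space over the computable scalars
   only, so linearity refers to those. *)
Definition linear_operator_on (R : realType) (cplx : bool)
    (X : completeNormedModType (scalars R cplx)) (Xk : set X) (T : X -> X) :
    Prop :=
  [/\ forall x, Xk x -> Xk (T x),
      forall x y, Xk x -> Xk y -> T (x + y) = T x + T y
    & forall (c : scalars R cplx) x, computable_scalar c -> Xk x ->
        T (c *: x) = c *: T x].

Definition effective_operator (K : numFieldType) (X : normedModType K)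
    (phi : nat -> nat -> option nat) (a : nat -> X) (T : X -> X) : Prop :=
  exists2 psi : nat -> option nat, partial_recursive1 psi &
    forall e x, std_numbering phi a e x ->
      exists2 e', psi e = Some e' & std_numbering phi a e' (T x).

(* Main.v *)
Require Import Defs.
From HB Require Import structures.
From mathcomp Require Import all_boot all_order all_algebra.
From mathcomp Require Import complex.
From mathcomp Require Import all_classical all_reals all_analysis.
From mathcomp Require Import zify ring.

(**
  The operator [T] is continuous at every computable point [x] along the
  rational span.  Otherwise one can search for elements [a (b n)] of the rational
  span with [`|a (b n) - x| < 2 ^- n] whose images stay at a fixed distance from
  [T x].  To a program [h] associate the element that is [x] if [h] never halts
  and [a (b n)] if [h] halts at stage [n]: it is computable uniformly in [h],
  since up to stage [n] approximations of [x] also approximate [a (b n)].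
  An approximation of its image under [T] then decides whether [h] halts.

  Continuity at computable points and additivity make [T] uniformly continuous
  on the dense set of computable elements, so [T] extends by completeness;
  linearity passes to the limit because the computable scalars are dense.
*)

Set Implicit Arguments.
Unset Strict Implicit.
Unset Printing Implicit Defensive.

Import Order.TTheory GRing.Theory Num.Theory.
Import numFieldNormedType.Exports.

Local Open Scope nat_scope.

(** * Total recursive functions *)

(* Arguments are passed as a sequence, of which only those of size [k] matter, so
   that variables are read by [nth 0] and bound by [cons]. *)
Definition rec (k : nat) (F : seq nat -> nat) : Prop :=
  exists c : recfun k, forall (v : k.-tuple nat) y, F v = y <-> rf_eval c v y.

Lemma rec_ext k F G : (forall v, size v = k -> F v = G v) -> rec k F -> rec k G.
Proof.
move=> FG [c Hc]; exists c => v y; rewrite -FG ?size_tuple //; exact: Hc.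
Qed.

Lemma rec_zero k : rec k (fun=> 0).
Proof. by exists (RZero k) => v y; split=> [<-|->]. Qed.

Lemma rec_nth k i : rec k (fun v => nth 0 v i).
Proof.
have [lt_ik|le_ki] := ltnP i k.
  exists (RProj (Ordinal lt_ik)) => v y /=.
  by rewrite (tnth_nth 0) /=; split=> ->.
apply: rec_ext (rec_zero k) => v sv; by rewrite nth_default ?sv.
Qed.

Lemma partial_recursive_comp k m (F : m.-tuple nat -> option nat)
    (g : 'I_m -> seq nat -> nat) :
  partial_recursive F -> (forall i, rec k (g i)) ->
  partial_recursive (fun v : k.-tuple nat => F [tuple g i v | i < m]).
Proof.
move=> [c Hc] /choice[d Hd]; exists (RComp c d) => v y /=; split=> [Fy|].
  exists [tuple g i v | i < m]; split; last exact/Hc.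
  by move=> i; rewrite tnth_mktuple; apply/Hd.
move=> [w [wd /Hc <-]]; congr F; apply: eq_from_tnth => i.
by rewrite tnth_mktuple; apply/Hd.
Qed.

Lemma recursive_of_partial k (F : k.-tuple nat -> option nat) (G : seq nat -> nat) :
  partial_recursive F -> (forall v, F v = Some (G v)) -> rec k G.
Proof.
move=> [c Hc] FG; exists c => v y; rewrite -Hc FG.
by split=> [->|[]].
Qed.

Lemma partial_of_recursive k (F : k.-tuple nat -> option nat) (G : seq nat -> nat) :
  rec k G -> (forall v, F v = Some (G v)) -> partial_recursive F.
Proof.
by move=> [c Hc] FG; exists c => v y; rewrite -Hc FG; split=> [[]|->].
Qed.

Lemma rec_ord_comp k m (F : seq nat -> nat) (g : 'I_m -> seq nat -> nat) :
  rec m F -> (forall i, rec k (g i)) ->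
  rec k (fun v => F (mktuple (fun i => g i v))).
Proof.
move=> rF rg.
have pF : partial_recursive (fun w : m.-tuple nat => Some (F w)).
  exact: (partial_of_recursive rF).
exact: (recursive_of_partial (partial_recursive_comp pF rg)).
Qed.

Lemma rec_comp k (F : seq nat -> nat) (gs : seq (seq nat -> nat)) :
  rec (size gs) F -> (forall i, i < size gs -> rec k (nth (fun=> 0) gs i)) ->
  rec k (fun v => F [seq g v | g <- gs]).
Proof.
move=> rF rg.
apply: rec_ext (rec_ord_comp (g := fun i => nth (fun=> 0) gs i) rF _).
- move=> v _; congr F; apply: (@eq_from_nth _ 0).
    by rewrite size_tuple size_map.
  move=> i; rewrite size_tuple => lti.
  have := tnth_mktuple (fun i : 'I_(size gs) => nth (fun=> 0) gs i v) (Ordinal lti).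
  by rewrite (tnth_nth 0) /= => ->; rewrite (nth_map (fun=> 0)).
- by move=> i; apply: rg.
Qed.

Lemma rec_comp1 k F g :
  rec 1 F -> rec k g -> rec k (fun v => F [:: g v]).
Proof. by move=> rF rg; apply: (@rec_comp k F [:: g]) => // -[]. Qed.

Lemma rec_comp2 k F g1 g2 :
  rec 2 F -> rec k g1 -> rec k g2 -> rec k (fun v => F [:: g1 v; g2 v]).
Proof. by move=> rF r1 r2; apply: (@rec_comp k F [:: g1; g2]) => // -[|[]]. Qed.

(** The general tool for permuting, dropping, duplicating or replacing variables: it suffices to
    compute each entry of [s v]. The size condition is needed because [rec m F] constrains [F] on
    sequences of size [m] only. *)
Lemma rec_subst k m F (s : seq nat -> seq nat) :
  rec m F -> (forall v, size v = k -> size (s v) = m) ->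
  (forall i, rec k (fun v => nth 0 (s v) i)) ->
  rec k (fun v => F (s v)).
Proof.
move=> rF ss rs.
have := @rec_comp k F (mkseq (fun i v => nth 0 (s v) i) m).
rewrite size_mkseq => /(_ rF) H; apply: rec_ext (H _).
  move=> v sv; congr F; apply: (@eq_from_nth _ 0).
    by rewrite size_map size_mkseq ss.
  move=> i; rewrite size_map size_mkseq => lti.
  by rewrite (nth_map (fun=> 0)) ?size_mkseq // nth_mkseq.
by move=> i lti; rewrite nth_mkseq.
Qed.

Lemma rec_cons k F g : rec k.+1 F -> rec k g -> rec k (fun v => F (g v :: v)).
Proof.
move=> rF rg; apply: (rec_subst rF) => [v /= ->//|[|i]//=]; exact: rec_nth.
Qed.

Lemma rec_succ k g : rec k g -> rec k (fun v => (g v).+1).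
Proof.
move=> rg; apply: (@rec_comp1 k (fun v => (nth 0 v 0).+1) g) => //.
exists RSucc => v y /=; rewrite /thead (tnth_nth 0) /=.
by split=> [<-|->].
Qed.

Lemma rec_const k n : rec k (fun=> n).
Proof. by elim: n => [|n IH]; [exact: rec_zero | exact: rec_succ]. Qed.

Lemma rec_iteri k F G g : rec k F -> rec k.+2 G -> rec k g ->
  rec k (fun v => iteri (g v) (fun i a => G (i :: a :: v)) (F v)).
Proof.
move=> [cF HF] [cG HG] rg.
(* [RPrec] recurses on its first argument, so the recursion is built with the bound in front;
   [rec_cons] then puts [g v] there. *)
pose P v := iteri (head 0 v) (fun i a => G (i :: a :: behead v)) (F (behead v)).
apply: (@rec_cons k P g) => //; exists (RPrec cF cG) => v y /=.
have -> : thead v = head 0 v by case/tupleP: v.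
rewrite /P; set w := behead_tuple v.
set n := head 0 v; split=> [<-|].
  exists (fun i => iteri i (fun i a => G (i :: a :: w)) (F w)); split=> //=.
    exact/(HF w).
  by move=> i _; apply/(HG [tuple of i :: _ :: w]).
move=> [h [h0 hS ->]].
suff H i : i <= n -> iteri i (fun i a => G [:: i, a & w]) (F w) = h i.
  exact: H.
elim: i => [_|i IH lti] /=; first exact/(HF w).
by apply/(HG [tuple of i :: _ :: w]); rewrite IH ?(ltnW lti) //; apply: hS.
Qed.

Lemma rec_weak2 k f : rec k f -> rec k.+2 (fun v => f (behead (behead v))).
Proof.
move=> rf; apply: (rec_subst rf) => [v|i]; first by rewrite !size_behead => ->.
by apply: rec_ext (rec_nth _ i.+2) => v _; rewrite !nth_behead.
Qed.

Lemma rec_weak k f : rec k f -> rec k.+1 (fun v => f (behead v)).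
Proof.
move=> rf; apply: (rec_subst rf) => [v|i]; first by rewrite size_behead => ->.
by apply: rec_ext (rec_nth _ i.+1) => v _; rewrite nth_behead.
Qed.

Lemma rec_add k f g : rec k f -> rec k g -> rec k (fun v => f v + g v).
Proof.
move=> rf rg.
have := rec_iteri rf (rec_succ (rec_nth k.+2 1)) rg.
apply: rec_ext => v _ /=.
by elim: (g v) => [|n IH] /=; rewrite ?addn0 // IH addnS.
Qed.

Lemma rec_mul k f g : rec k f -> rec k g -> rec k (fun v => f v * g v).
Proof.
move=> rf rg.
have := rec_iteri (rec_zero k) (rec_add (rec_nth k.+2 1) (rec_weak2 rf)) rg.
apply: rec_ext => v _ /=.
by elim: (g v) => [|n IH] /=; rewrite ?muln0 // IH mulnS addnC.
Qed.

Lemma rec_exp k f g : rec k f -> rec k g -> rec k (fun v => f v ^ g v).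
Proof.
move=> rf rg.
have := rec_iteri (rec_const k 1) (rec_mul (rec_nth k.+2 1) (rec_weak2 rf)) rg.
apply: rec_ext => v _ /=.
by elim: (g v) => [|n IH] /=; rewrite ?expn0 // IH expnSr.
Qed.

Lemma rec_pred k f : rec k f -> rec k (fun v => (f v).-1).
Proof.
move=> rf.
have := rec_iteri (rec_zero k) (rec_nth k.+2 0) rf.
by apply: rec_ext => v _ /=; case: (f v).
Qed.

Lemma rec_sub k f g : rec k f -> rec k g -> rec k (fun v => f v - g v).
Proof.
move=> rf rg.
have := rec_iteri rf (rec_pred (rec_nth k.+2 1)) rg.
apply: rec_ext => v _ /=.
by elim: (g v) => [|n IH] /=; rewrite ?subn0 // IH subnS.
Qed.

(** * Decidable predicates, bounded and unbounded search *)

Definition recb (k : nat) (P : seq nat -> bool) : Prop :=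
  rec k (fun v => nat_of_bool (P v)).

Lemma recb_leq k f g : rec k f -> rec k g -> recb k (fun v => f v <= g v).
Proof.
move=> rf rg; apply: rec_ext (rec_sub (rec_const k 1) (rec_sub rf rg)) => v _.
lia.
Qed.

Lemma recb_ltn k f g : rec k f -> rec k g -> recb k (fun v => f v < g v).
Proof. by move=> rf; apply: recb_leq; apply: rec_succ. Qed.

Lemma recb_and k P Q : recb k P -> recb k Q -> recb k (fun v => P v && Q v).
Proof. by move=> rP rQ; apply: rec_ext (rec_mul rP rQ) => v _; lia. Qed.

Lemma recb_eq k f g : rec k f -> rec k g -> recb k (fun v => f v == g v).
Proof.
move=> rf rg; apply: rec_ext (recb_and (recb_leq rf rg) (recb_leq rg rf)) => v _.
by rewrite eqn_leq.
Qed.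

Lemma rec_if k P f g : recb k P -> rec k f -> rec k g ->
  rec k (fun v => if P v then f v else g v).
Proof.
move=> rP rf rg.
have := rec_add (rec_mul rP rf) (rec_mul (rec_sub (rec_const k 1) rP) rg).
by apply: rec_ext => v _; case: (P v); lia.
Qed.

(* The least [i < n] with [P i], and [n] if there is none. *)
Definition bmin (P : nat -> bool) (n : nat) : nat :=
  iteri n (fun i a => if a < i then a else if P i then i else i.+1) 0.

Lemma bminP (P : nat -> bool) n : (forall i, i < bmin P n -> ~~ P i) /\
  (bmin P n = n \/ bmin P n < n /\ P (bmin P n)).
Proof.
rewrite /bmin; elim: n => [|n [IH1 IH2]] /=; first by split=> //; left.
move: IH1 IH2; set b := iteri _ _ _ => IH1 IH2.
case: IH2 => [bn|[ltb Pb]]; last by rewrite ltb; split=> //; right; split; lia.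
rewrite bn ltnn; rewrite bn in IH1; case: ifP => Pn; first by split=> //; right.
by split; [move=> i; rewrite ltnS leq_eqVlt => /orP[/eqP->|/IH1//]; rewrite Pn | left].
Qed.

Lemma bmin_lt (P : nat -> bool) n : reflect (exists2 i, i < n & P i) (bmin P n < n).
Proof.
have [H1 H2] := bminP P n; apply: (iffP idP) => [lt|[i ltin Pi]].
  by case: H2 => [e|[_ Pb]]; [move: lt; rewrite e ltnn | exists (bmin P n)].
by case: H2 => [e|[]//]; move: (H1 i); rewrite e Pi => /(_ ltin).
Qed.

Lemma bmin_eq (P : nat -> bool) n i : i < n -> P i -> (forall j, j < i -> ~~ P j) ->
  bmin P n = i.
Proof.
move=> ltin Pi Hi; have [H1 H2] := bminP P n.
apply/eqP; rewrite eqn_leq; apply/andP; split.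
  by rewrite leqNgt; apply/negP => /H1; rewrite Pi.
rewrite leqNgt; apply/negP => lt; case: H2 => [e|[_ Pb]]; first by lia.
by move: (Hi _ lt); rewrite Pb.
Qed.

Lemma rec_bmin k P g : recb k.+1 P -> rec k g ->
  rec k (fun v => bmin (fun i => P (i :: v)) (g v)).
Proof.
move=> rP; apply: (rec_iteri (rec_zero k)
  (G := fun v => if nth 0 v 1 < nth 0 v 0 then nth 0 v 1 else
    if P (nth 0 v 0 :: behead (behead v)) then nth 0 v 0 else (nth 0 v 0).+1)).
apply: rec_if; [apply: recb_ltn; exact: rec_nth | exact: rec_nth |].
apply: rec_if; [|exact: rec_nth | apply: rec_succ; exact: rec_nth].
apply: (rec_subst rP) => [v sv /=|[|i]] /=.
- by rewrite !size_behead sv.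
- exact: rec_nth.
- by apply: rec_ext (rec_nth _ i.+2) => v _; rewrite !nth_behead.
Qed.

Lemma recb_exists k P g : recb k.+1 P -> rec k g ->
  recb k (fun v => bmin (fun i => P (i :: v)) (g v) < g v).
Proof. by move=> rP rg; apply: recb_ltn => //; apply: rec_bmin. Qed.

Lemma rec_mu k P : recb k.+1 P ->
  (forall v, size v = k -> exists i, P (i :: v)) ->
  exists2 g, rec k g & forall v, size v = k -> P (g v :: v).
Proof.
move=> rP exP.
(* [RMu] looks for a zero, so the characteristic function is inverted. *)
have [c Hc] : rec k.+1 (fun v => 1 - P v).
  by apply: rec_sub rP; exact: rec_const.
pose Q v : Prop := exists i, P (i :: v).
(* The default 0 is never taken on sequences of size [k], by [exP]. *)
pose g v := if pselect (Q v) is left h then ex_minn h else 0.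
have gP v : size v = k -> P (g v :: v).
  move=> /exP Qv; rewrite /g; case: pselect => // h; by case: ex_minnP.
exists g => //; exists (RMu c) => v y /=.
have Pgv : P (g v :: v) by apply: gP; rewrite size_tuple.
have Mgv i : P (i :: v) -> g v <= i.
  rewrite /g; case: pselect => // h; case: ex_minnP => m _; exact.
split=> [<-|[y0 ylt]].
  split; first by apply/(Hc [tuple of g v :: v]); rewrite /= Pgv.
  move=> i lti; exists 0; apply/(Hc [tuple of i :: v]) => /=.
  by case Pi: (P _) => //; move: (Mgv _ Pi); lia.
have Py : P (y :: v).
  by move/(Hc [tuple of y :: v]): y0 => /=; case: (P _).
apply/eqP; rewrite eqn_leq Mgv //= leqNgt; apply/negP => /ylt[z].
by move/(Hc [tuple of g v :: v]) => /=; rewrite Pgv.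
Qed.

(** * Recursive and partial recursive functions of one and two arguments *)

Lemma recursive1P f : recursive1 f <-> rec 1 (fun v => f (nth 0 v 0)).
Proof.
split=> [rf|rf]; [apply: (recursive_of_partial rf) | apply: (partial_of_recursive rf)];
by move=> v; rewrite (tnth_nth 0).
Qed.

Lemma recursive2P f : recursive2 f <-> rec 2 (fun v => f (nth 0 v 0) (nth 0 v 1)).
Proof.
split=> [rf|rf]; [apply: (recursive_of_partial rf) | apply: (partial_of_recursive rf)];
by move=> v; rewrite !(tnth_nth 0).
Qed.

Lemma rec_app1 k f g : recursive1 f -> rec k g -> rec k (fun v => f (g v)).
Proof. by move/recursive1P => rf rg; have := rec_comp1 rf rg. Qed.

Lemma rec_app2 k f g h : recursive2 f -> rec k g -> rec k h ->
  rec k (fun v => f (g v) (h v)).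
Proof. by move/recursive2P => rf rg rh; have := rec_comp2 rf rg rh. Qed.

(** Serves to run partial functions such as [psi] at places where a value is guaranteed. *)
Lemma rec_papp1 k f g h : partial_recursive1 f -> rec k g ->
  (forall v, f (g v) = Some (h v)) -> rec k h.
Proof.
move=> pf rg fgh.
have := partial_recursive_comp (g := fun=> g) pf (fun=> rg).
by move/recursive_of_partial; apply => v; rewrite tnth_mktuple.
Qed.

Lemma rec_papp2 k f g1 g2 h : partial_recursive2 f -> rec k g1 -> rec k g2 ->
  (forall v, f (g1 v) (g2 v) = Some (h v)) -> rec k h.
Proof.
move=> pf r1 r2 fgh.
have := partial_recursive_comp (g := fun i : 'I_2 => if i == 0 :> nat then g1 else g2) pf.
have H (i : 'I_2) : rec k (if i == 0 :> nat then g1 else g2) by case: ifP.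
by move/(_ k H)/recursive_of_partial; apply => v; rewrite !tnth_mktuple.
Qed.

(** * The halting problem in stages *)

(* [G n v] is [y.+1] once [c] has been seen to halt on [v] with value [y]
   within the resources [n], and [0] before that. *)
Definition stage_evaluator k (c : recfun k) (G : nat -> seq nat -> nat) : Prop :=
  [/\ rec k.+1 (fun v => G (head 0 v) (behead v)),
      forall v n n', n <= n' -> G n v != 0 -> G n' v = G n v
    & forall (v : k.-tuple nat) y, rf_eval c v y <-> exists n, G n v = y.+1].

Lemma rec_head k : rec k (head 0).
Proof. by apply: rec_ext (rec_nth k 0) => -[]. Qed.

Lemma rec_prod k m (F : 'I_m -> seq nat -> nat) :
  (forall i, rec k (F i)) -> rec k (fun v => \prod_(i < m) F i v).
Proof.
elim: m F => [|m IH] F rF.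
  by apply: rec_ext (rec_const k 1) => v _; rewrite big_ord0.
apply: rec_ext (rec_mul (rF ord0) (IH (fun i => F (lift ord0 i)) _)) => [v _|i].
  by rewrite big_ord_recl.
exact: rF.
Qed.

Lemma prodn_neq0 m (F : 'I_m -> nat) :
  (\prod_(i < m) F i != 0) = [forall i, F i != 0].
Proof.
rewrite -lt0n; apply/idP/forallP => [H i|H].
  by move: H; rewrite (bigD1 i) //= muln_gt0 lt0n => /andP[].
by apply: prodn_gt0 => i; rewrite lt0n.
Qed.

Lemma stage_evaluator_value k (f : seq nat -> nat) (c : recfun k) :
  rec k f -> (forall (v : k.-tuple nat) y, f v = y <-> rf_eval c v y) ->
  stage_evaluator c (fun _ v => (f v).+1).
Proof.
move=> rf Hc; split=> //; first by apply: rec_succ; apply: rec_weak.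
move=> v y; rewrite -Hc; split=> [->|[_ []]//]; by exists 0.
Qed.

(** The product of the inner stage values is nonzero exactly when all inner computations have been
    seen to halt; their predecessors are then the arguments of the outer one. Finitely many halting
    stages have a common bound, and monotonicity carries every value there. *)
Lemma stage_evaluator_comp k m (f : recfun m) (g : 'I_m -> recfun k) Gf Gg :
  stage_evaluator f Gf -> (forall i, stage_evaluator (g i) (Gg i)) ->
  stage_evaluator (RComp f g)
    (fun n v => if \prod_(i < m) Gg i n v != 0
                then Gf n (mktuple (fun i => (Gg i n v).-1)) else 0).
Proof.
move=> [rf mf Hf] Hg.
have rg i : rec k.+1 (fun v => Gg i (head 0 v) (behead v)) by case: (Hg i).
have mg i : forall v n n', n <= n' -> Gg i n v != 0 -> Gg i n' v = Gg i n v.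
  by case: (Hg i).
split.
- apply: rec_if; last exact: rec_zero.
    apply: rec_ext (recb_ltn (rec_const _ 0) (rec_prod rg)) => v _.
    by rewrite lt0n.
  (* The outer evaluator takes the stage as an additional first argument. *)
  pose h (i : 'I_m.+1) (v : seq nat) :=
    if unlift ord0 i is Some j then (Gg j (head 0 v) (behead v)).-1 else head 0 v.
  apply: rec_ext (rec_ord_comp (g := h) rf _) => [v _|i].
    have -> : mktuple (fun i => h i v) =
      [tuple of head 0 v :: [tuple (Gg i (head 0 v) (behead v)).-1 | i < m]].
      apply: eq_from_tnth => i; rewrite tnth_mktuple /h.
      case: unliftP => [j ->|->]; last by rewrite tnth0.
      by rewrite tnthS tnth_mktuple.
    by [].
  rewrite /h; case: (unlift ord0 i) => [j|]; last exact: rec_head.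
  exact: rec_pred.
- move=> v n n' le; case: ifP => // nz Gnz.
  have E i : Gg i n' v = Gg i n v.
    by apply: mg => //; move: nz; rewrite prodn_neq0 => /forallP.
  have -> : \prod_(i < m) Gg i n' v = \prod_(i < m) Gg i n v.
    by apply: eq_bigr => i _.
  have -> : [tuple (Gg i n' v).-1 | i < m] = [tuple (Gg i n v).-1 | i < m].
    by apply: eq_from_tnth => i; rewrite !tnth_mktuple E.
  by rewrite nz; apply: mf.
- move=> v y /=; split=> [[w [gw /Hf[nf Enf]]]|[n]].
    have /choice[ng Eng] i : exists n, Gg i n v = (tnth w i).+1.
      by case: (Hg i) => _ _ H; apply/H.
    pose N := maxn nf (\max_i ng i).
    have E i : Gg i N v = (tnth w i).+1.
      rewrite (mg i v (ng i)) ?Eng //; apply: leq_trans (leq_maxr _ _).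
      exact: leq_bigmax.
    exists N; rewrite prodn_neq0; case: ifP => [_|/forallP[] i]; last by rewrite E.
    have -> : [seq (Gg i N v).-1 | i <- enum 'I_m] = w.
      suff <- : [tuple (Gg i N v).-1 | i < m] = w by [].
      by apply: eq_from_tnth => i; rewrite tnth_mktuple E.
    by rewrite (mf _ nf) ?leq_maxl ?Enf.
  case: ifP => //; rewrite prodn_neq0 => /forallP nz EG.
  exists [tuple (Gg i n v).-1 | i < m]; split; last by apply/Hf; exists n.
  move=> i; rewrite tnth_mktuple; case: (Hg i) => _ _ H; apply/H; exists n.
  by rewrite prednK // lt0n.
Qed.

(** The accumulator holds the current value plus one, or 0 if some computation has not yet halted;
    once 0 it stays 0. *)
Lemma stage_evaluator_prec k (f : recfun k) (g : recfun k.+2) Gf Gg :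
  stage_evaluator f Gf -> stage_evaluator g Gg ->
  stage_evaluator (RPrec f g)
    (fun n v => iteri (head 0 v)
       (fun i b => if b == 0 then 0 else Gg n (i :: b.-1 :: behead v))
       (Gf n (behead v))).
Proof.
move=> [rf mf Hf] [rg mg Hg].
pose h n w i :=
  iteri i (fun i b => if b == 0 then 0 else Gg n [:: i, b.-1 & w]) (Gf n w).
have hE n w i : h n w i.+1 =
  if h n w i == 0 then 0 else Gg n [:: i, (h n w i).-1 & w] by [].
have hm n n' w i : n <= n' -> h n w i != 0 -> h n' w i = h n w i.
  move=> le; elim: i => [|i IH]; first exact: mf.
  rewrite !hE; case: (eqVneq (h n w i) 0) => // nz; rewrite IH // (negbTE nz).
  exact: mg.
split.
(* The body of the iteration sees counter, accumulator, stage, recursion argument and parameters;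
   [t] rearranges them into stage, counter, decoded value and parameters. *)
- pose t (v : seq nat) := [:: nth 0 v 2, nth 0 v 0, (nth 0 v 1).-1
    & behead (behead (behead (behead v)))].
  apply: (@rec_iteri k.+2 (fun v => Gf (head 0 v) (behead (behead v)))
    (fun v => if nth 0 v 1 == 0 then 0 else Gg (head 0 (t v)) (behead (t v)))
    (fun v => head 0 (behead v))).
  + pose u (v : seq nat) := head 0 v :: behead (behead v).
    apply: (rec_subst (s := u) rf) => [v /= |[|i]] /=.
    * by rewrite !size_behead => ->.
    * exact: rec_head.
    * by apply: rec_ext (rec_nth _ i.+2) => v _; rewrite !nth_behead.
  + apply: rec_if; [|exact: rec_zero|].
      by apply: recb_eq (rec_nth _ _) (rec_zero _).
    apply: (rec_subst (s := t) rg) => [v sv|[|[|[|i]]]] /=.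
    * by rewrite !size_behead sv.
    * exact: rec_nth.
    * exact: rec_nth.
    * by apply: rec_pred; exact: rec_nth.
    * by apply: rec_ext (rec_nth _ i.+4) => v _; rewrite !nth_behead.
  + by apply: rec_ext (rec_nth _ 1) => v _; case: v => [|? []].
- by move=> v n n' le; apply: hm.
- move=> v y /=.
  have -> : thead v = head 0 v by case/tupleP: v.
  set w := behead_tuple v; set N := head 0 v; split=> [[p [p0 pS ->]]|[n En]].
    have H i : i <= N -> exists n, h n w i = (p i).+1.
      elim: i => [_|i IH lti]; first exact/Hf.
      have [n1 En1] := IH (ltnW lti).
      have /Hg[n2 En2] := pS i lti.
      exists (maxn n1 n2); rewrite hE.
      rewrite (hm n1) ?leq_maxl ?En1 //=.
      by rewrite (mg _ n2) ?leq_maxr ?En2.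
    exact: H.
  (* Since 0 propagates upwards, a nonzero final value forces all earlier ones to be nonzero. *)
  have nz i : i <= N -> h n w i != 0.
    move=> le; apply: contraTneq isT => hi0.
    suff : h n w N = 0 by rewrite /h En.
    rewrite -(subnKC le); elim: (N - i) => [|d IH]; first by rewrite addn0.
    by rewrite addnS hE IH.
  exists (fun i => (h n w i).-1); split.
  + by apply/Hf; exists n; rewrite prednK ?lt0n ?(nz 0).
  + move=> i lti; apply/Hg; exists n; rewrite prednK ?lt0n ?nz //.
    by rewrite hE (negbTE (nz i (ltnW lti))).
  + by rewrite /h En.
Qed.

(** The condition [Gf n (i :: v) <= 1] means that the value at [i] is still unknown or known to be
    0. The least such [b] is where the search stalls or succeeds, and the test [== 1] accepts
    success only. Below [b] all values are known to be positive, so later stages find the same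
    [b]. *)
Lemma stage_evaluator_mu k (f : recfun k.+1) Gf :
  stage_evaluator f Gf ->
  stage_evaluator (RMu f)
    (fun n v => let b := bmin (fun i => Gf n (i :: v) <= 1) n in
       if (b < n) && (Gf n (b :: v) == 1) then b.+1 else 0).
Proof.
move=> [rf mf Hf].
pose P n v i := Gf n (i :: v) <= 1.
have GP n v b : b < n -> Gf n (b :: v) = 1 ->
    (forall i, i < b -> 1 < Gf n (i :: v)) -> bmin (P n v) n = b.
  by move=> ltb Gb Gi; apply: bmin_eq => // [|j /Gi]; rewrite /P ?Gb // ltnNge.
have Gs n v b : bmin (P n v) n = b -> forall i, i < b -> 1 < Gf n (i :: v).
  by move=> <- i /(proj1 (bminP _ _)); rewrite /P ltnNge.
split.
- have rb : rec k.+1 (fun v => bmin (P (head 0 v) (behead v)) (head 0 v)).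
    pose t (v : seq nat) := [:: nth 0 v 1, nth 0 v 0 & behead (behead v)].
    apply: (@rec_bmin k.+1
      (fun v => Gf (head 0 (t v)) (behead (t v)) <= 1) (fun v => head 0 v)).
      apply: recb_leq (rec_const _ _).
      apply: (rec_subst (s := t) rf) => [v|[|[|i]]] /=.
      + by rewrite !size_behead => ->.
      + exact: rec_nth.
      + exact: rec_nth.
      + by apply: rec_ext (rec_nth _ i.+2) => v _; rewrite !nth_behead.
    exact: rec_head.
  apply: rec_if (rec_zero _); last exact: rec_succ.
  apply: recb_and; first by apply: recb_ltn rb (rec_head _).
  apply: recb_eq (rec_const _ _).
  pose t (v : seq nat) :=
    [:: head 0 v, bmin (P (head 0 v) (behead v)) (head 0 v) & behead v].
  apply: (rec_subst (s := t) rf) => [v|[|[|i]]] //=.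
  + by rewrite size_behead => ->.
  + exact: rec_head.
  + by apply: rec_ext (rec_nth _ i.+1) => v _; rewrite !nth_behead.
- move=> v n n' le /=; rewrite -/(P n v) -/(P n' v).
  case: ifP => // /andP[ltb /eqP Gb] _.
  suff E : bmin (P n' v) n' = bmin (P n v) n.
    by rewrite E (leq_trans ltb le) (mf _ n) ?Gb.
  apply: GP; [exact: leq_trans le | by rewrite (mf _ n) ?Gb |].
  move=> i /(Gs _ _ _ erefl) lt1; rewrite (mf _ n) //; by case: (Gf n _) lt1.
- move=> v y /=; split=> [[/Hf[n0 En0] ylt]|[n]].
    have /choice[ni Eni] (i : 'I_y) : exists n, 1 < Gf n ((i : nat) :: v).
      have [z /Hf[n En]] := ylt i (ltn_ord i).
      by exists n; rewrite En.
    (* The stage also bounds the search, so it must exceed [y] itself besides the stages of the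
       computations involved. *)
    pose N := maxn y.+1 (maxn n0 (\max_i ni i)).
    have yN : y < N by rewrite leq_max ltnSn.
    have GN : Gf N (y :: v) = 1.
      by rewrite (mf _ n0) ?En0 // /N; lia.
    exists N; rewrite -/(P N v) (GP N v y) // ?yN ?GN //.
    move=> i lti; have H := Eni (Ordinal lti); rewrite /= in H.
    have le : ni (Ordinal lti) <= N.
      by apply: leq_trans (leq_bigmax (Ordinal lti)) _; rewrite /N; lia.
    by rewrite (mf _ _ _ le) -?lt0n //; apply: ltn_trans H.
  rewrite -/(P n v); case: ifP => // /andP[ltb /eqP Gb] [<-].
  split; first by apply/Hf; exists n.
  move=> i lti; have := Gs _ _ _ erefl i lti.
  case E: (Gf n (i :: v)) => [|[|z]] // _.
  by exists z; apply/Hf; exists n.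
Qed.

Lemma stage_evaluator_exists k (c : recfun k) : exists G, stage_evaluator c G.
Proof.
elim: c => {k} [k||k i|k m f [Gf Hf] g Hg|k f [Gf Hf] g [Gg Hg]|k f [Gf Hf]].
- by eexists; apply: (stage_evaluator_value (rec_zero k)) => v y; split=> [<-|->].
- eexists; apply: (stage_evaluator_value (rec_succ (rec_nth 1 0))) => v y /=.
  by rewrite /thead (tnth_nth 0) /=; split=> [<-|->].
- eexists; apply: (stage_evaluator_value (rec_nth k i)) => v y /=.
  by rewrite (tnth_nth 0) /=; split=> [<-|->].
- have [Gg HGg] := choice Hg.
  by eexists; apply: stage_evaluator_comp Hf HGg.
- by eexists; apply: stage_evaluator_prec Hf Hg.
- by eexists; apply: stage_evaluator_mu Hf.
Qed.

(* [H e n] says that [phi e] is seen to halt on [e] by stage [n]. *)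
Lemma undecidable_stage_predicate phi : acceptable_numbering phi ->
  exists2 H : nat -> nat -> bool,
    recb 2 (fun v => H (nth 0 v 0) (nth 0 v 1)) &
    forall d : nat -> bool, recb 1 (fun v => d (nth 0 v 0)) ->
      ~ (forall e, d e <-> exists n, H e n).
Proof.
move=> [[c Hc] smn]; have [G [rG _ HG]] := stage_evaluator_exists c.
exists (fun e n => G n [:: e; e] != 0).
  pose t (v : seq nat) := [:: nth 0 v 1; nth 0 v 0; nth 0 v 0].
  apply: rec_ext (recb_ltn (rec_zero 2) (rec_subst (s := t) rG _ _)) => //.
    by move=> v _; rewrite lt0n.
  by move=> [|[|[|i]]] /=; rewrite ?nth_nil; [exact: rec_nth..|exact: rec_zero].
move=> d [cd Hd] dH.
(* Diagonalization: [D] diverges where [d] predicts halting and halts elsewhere. The first argument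
   is a dummy for the s-m-n property. *)
pose D (x y : nat) : option nat := if d y then None else Some 0.
have pD : partial_recursive2 D.
  have [cD HcD] : rec 3 (fun v => nat_of_bool (d (nth 0 v 2))).
    have rd : recb 1 (fun v => d (nth 0 v 0)) by exists cd.
    exact: (rec_comp1 rd (rec_nth 3 2)).
  (* The function searched does not depend on the search variable: the search stops at 0 if [d] is
     false and never stops otherwise. *)
  exists (RMu cD) => v y; rewrite /D (tnth_nth 0) /=.
  have HD i z : rf_eval cD [tuple of i :: v] z <-> nat_of_bool (d (nth 0 v 1)) = z.
    by rewrite -HcD /=.
  split=> [|[/HD y0 ylt]].
    case E: (d _) => // -[<-]; split=> //; apply/HD; by rewrite E.
  case E: (d _) y0 => // _; case: y ylt => // y /(_ 0 isT)[z /HD].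
  by rewrite E.
have [s _ phis] := smn D pD; set e := s 0.
have phie : (exists n, G n [:: e; e] != 0) <-> exists y, phi e e = Some y.
  split=> [[n nz]|[y /(Hc [tuple e; e])/HG[n En]]].
    exists (G n [:: e; e]).-1; apply/(Hc [tuple e; e])/HG; exists n => /=.
    by rewrite prednK // lt0n.
  by exists n; rewrite En.
have := dH e; rewrite phie phis /D; case: (d e) => [[/(_ isT)[]//]|[_ H]].
by have := H (ex_intro _ 0 erefl).
Qed.

Local Open Scope classical_set_scope.
Local Open Scope ring_scope.

(** * Computable scalars and norms *)

(** In the complex case [0 < eps] forces the imaginary part to vanish, so the archimedean property
    of the reals applies. *)
Lemma scalars_small_pow2 (R : realType) cplx (eps : scalars R cplx) :
  0 < eps -> exists n, 2 ^- n < eps.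
Proof.
have aux (x : R) : 0 < x -> exists n, 2 ^- n < x.
  move=> x0; exists (Num.bound x^-1).
  rewrite -[x in ltRHS]invrK ltf_pV2 ?posrE ?invr_gt0 ?exprn_gt0 //.
  exact: upper_nthrootP.
case: cplx eps => /= [[x y]|]; last exact: aux.
rewrite ltcE /= => /andP[/eqP -> /aux[n xn]]; exists n.
have -> : (2 : R[i]) ^- n = (2 ^- n : R)%:C%C.
  by rewrite fmorphV rmorphXn /= rmorph_nat.
by rewrite ltcR.
Qed.

Lemma scalars_rational_approx (R : realType) cplx (c eps : scalars R cplx) :
  0 < eps ->
  exists pq : rat * rat, `|c - (ratr pq.1 + im_unit R cplx * ratr pq.2)| < eps.
Proof.
have aux (x d : R) : 0 < d -> exists p : rat, `|x - ratr p| < d.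
  move=> d0; have /rat_in_itvoo[p] : x - d < x + d by rewrite ltrD2l gt0_cp.
  by rewrite in_itv /= => pd; exists p; rewrite distrC ltr_distl.
case: cplx c eps => /= [z eps|c eps]; last first.
  by move=> /(aux c)[p Hp]; exists (p, 0); rewrite mul0r addr0.
case: eps => d d'; rewrite ltcE /= => /andP[/eqP -> d0].
have d2 : 0 < d / 2 by rewrite divr_gt0.
have [p Hp] := aux (complex.Re z) _ d2; have [q Hq] := aux (complex.Im z) _ d2.
have nC (x : R) : `|x%:C%C| = `|x|%:C%C.
  by rewrite normc_def /= expr0n addr0 sqrtr_sqr.
exists (p, q) => /=.
rewrite [z in z - _]complexE complexiE -!(fmorph_rat (@real_complex R)).
have -> : (complex.Re z)%:C%C + 'i * (complex.Im z)%:C%C -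
    ((ratr p)%:C%C + 'i * (ratr q)%:C%C) =
    (complex.Re z - ratr p)%:C%C + 'i * (complex.Im z - ratr q)%:C%C.
  by rewrite !rmorphB /=; ring.
apply: le_lt_trans (ler_normD _ _) _.
rewrite normrM normCi mul1r !nC.
have -> : (d +i* 0)%C = (d / 2)%:C%C + (d / 2)%:C%C by rewrite -rmorphD /= -splitr.
by rewrite ltrD // ltcR.
Qed.

(** Doubling removes the halving, since a product of consecutive numbers is even; the pairing
    becomes accessible to polynomial arithmetic. *)
Lemma cpairE n k : (cpair n k * 2 = (n + k) * (n + k).+1 + k * 2)%N.
Proof.
rewrite /cpair mulnDl muln2 even_halfK //.
by rewrite oddM /= andbN.
Qed.

Lemma cpair_inj n k n' k' : cpair n k = cpair n' k' -> n = n' /\ k = k'.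
Proof.
move=> E; have := cpairE n k; rewrite E cpairE.
have [lt|lt|eq] := ltngtP (n + k) (n' + k'); last by rewrite eq; lia.
- by nia.
- by nia.
Qed.

(** Bounds the search that decodes a pair. *)
Lemma leq_cpair n k : (n <= cpair n k)%N /\ (k <= cpair n k)%N.
Proof. have := cpairE n k; nia. Qed.

(** A sequence of rationals is its own approximation at every precision. *)
Lemma computable_real_seq_sign_nat (K : numFieldType) (s : nat) (p q : nat -> nat) :
  recursive1 p -> recursive1 q -> (forall n, q n != 0%N) ->
  computable_real_seq (fun n => (-1) ^+ s * (p n)%:R / (q n)%:R : K).
Proof.
move=> rp rq q0; exists (fun n _ => (-1) ^+ s * (p n)%:R / (q n)%:R).
  exists (fun _ _ => s), (fun n _ => p n), (fun n _ => q n); split => //.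
  - by apply/recursive2P; exact: rec_const.
  - by apply/recursive2P; apply: rec_app1 => //; exact: rec_nth.
  - by apply/recursive2P; apply: rec_app1 => //; exact: rec_nth.
by move=> n k; rewrite subrr normr0 invr_ge0 exprn_ge0.
Qed.

Lemma computable_scalar_seq_real (R : realType) cplx (x : nat -> scalars R cplx) :
  computable_real_seq x -> computable_scalar_seq x.
Proof.
move=> cx; exists x, (fun=> 0); split=> // [|n]; last by rewrite mulr0 addr0.
have -> : (fun=> 0) = (fun n : nat => (-1) ^+ 0 * 0%:R / 1%:R : scalars R cplx).
  by apply: funext => n; rewrite mulr0 mul0r.
by apply: (computable_real_seq_sign_nat _ 0 (p := fun=> 0%N) (q := fun=> 1%N)) => //;
  apply/recursive1P; exact: rec_const.
Qed.

(** Supplies the coefficients 0, 1 and -1 for the linear forms of a computability structure. A code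
    [t] is decoded by bounded search in [E], and injectivity of [cpair] makes the pair found the
    right one. *)
Lemma double_seq_indicator (R : realType) cplx (P : nat -> nat -> bool) (s : nat) :
  recb 2 (fun v => P (nth 0%N v 0) (nth 0%N v 1)) ->
  double_seq (@computable_scalar_seq R cplx)
    (fun n k => (-1) ^+ s * (P n k)%:R).
Proof.
move=> rP.
pose E t := (bmin (fun n => bmin (fun k =>
   ((n + k) * (n + k).+1 + k * 2 == t * 2) && P n k) t.+1 < t.+1) t.+1 < t.+1)%N.
have EP n k : E (cpair n k) = P n k.
  apply/bmin_lt/idP => [[n' _] /bmin_lt[k' _] /andP[]|Pnk].
    rewrite -!cpairE !muln2 => /eqP/double_inj/cpair_inj[-> ->]; done.
  have [ln lk] := leq_cpair n k.
  exists n => //; apply/bmin_lt; exists k => //.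
  by rewrite cpairE eqxx.
exists (fun t => (-1) ^+ s * (E t)%:R); last by move=> n k; rewrite EP.
apply: computable_scalar_seq_real.
have -> : (fun t => (-1) ^+ s * (E t)%:R : scalars R cplx) =
   (fun t => (-1) ^+ s * (E t)%:R / 1%:R).
  by apply: funext => t; rewrite divr1.
apply: (computable_real_seq_sign_nat _ s (p := E) (q := fun=> 1%N)) => //;
  last by apply/recursive1P; exact: rec_const.
apply/recursive1P.
have rS : rec 1 (fun v => (nth 0 v 0).+1)%N by apply: rec_succ; exact: rec_nth.
apply: (@recb_exists 1 (fun v => (bmin (fun k =>
  ((nth 0 v 0 + k) * (nth 0 v 0 + k).+1 + k * 2 == nth 0 v 1 * 2) &&
   P (nth 0 v 0) k) (nth 0 v 1).+1 < (nth 0 v 1).+1))%N _ _ rS).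
apply: (@recb_exists 2 (fun v =>
  (((nth 0 v 1 + nth 0 v 0) * (nth 0 v 1 + nth 0 v 0).+1 + nth 0 v 0 * 2
   == nth 0 v 2 * 2) && P (nth 0 v 1) (nth 0 v 0)))%N); last first.
  by apply: rec_succ; exact: rec_nth.
have rs : rec 3 (fun v => nth 0 v 1 + nth 0 v 0)%N.
  by apply: rec_add; exact: rec_nth.
apply: recb_and.
  apply: recb_eq; last by apply: rec_mul (rec_nth _ _) (rec_const _ _).
  apply: rec_add; last by apply: rec_mul (rec_nth _ _) (rec_const _ _).
  by apply: rec_mul rs (rec_succ rs).
exact: (rec_comp2 rP (rec_nth 3 1) (rec_nth 3 0)).
Qed.

Lemma computable_rational_scalar (R : realType) cplx (p q : rat) :
  computable_scalar (ratr p + im_unit R cplx * ratr q).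
Proof.
have aux (K : numFieldType) (r : rat) : computable_real_seq (fun=> ratr r : K).
  have -> : (fun=> ratr r) = (fun=> (-1) ^+ (numq r < 0)%R * (`|numq r|%N)%:R
      / (`|denq r|%N)%:R : K) :> (nat -> K).
    apply: funext => _; rewrite /ratr; congr (_ / _).
      rewrite -[in LHS](mulr_sign_norm (numq r)) rmorphM /= rmorph_sign.
      by rewrite -abszE.
    by rewrite -{1}(gtz0_abs (denq_gt0 r)).
  apply: (computable_real_seq_sign_nat _ (numq r < 0)%R
    (p := fun=> `|numq r|%N) (q := fun=> `|denq r|%N)).
  - by apply/recursive1P; exact: rec_const.
  - by apply/recursive1P; exact: rec_const.
  - by move=> _; rewrite absz_eq0 denq_neq0.
by exists (fun=> ratr p), (fun=> ratr q); split=> //; exact: aux.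
Qed.

(** Replacing the approximations by their absolute values does not increase the error when the limit
    is nonnegative. This removes the sign, so that comparisons can be made between natural
    numbers. *)
Lemma computable_real_seq_nonneg (K : numFieldType) (x : nat -> K) :
  computable_real_seq x -> (forall n, 0 <= x n) ->
  exists p q : nat -> nat -> nat,
    [/\ recursive2 p, recursive2 q, forall n k, q n k != 0%N &
      forall n k, (p n k)%:R / (q n k)%:R - 2 ^- k <= x n
                    <= (p n k)%:R / (q n k)%:R + 2 ^- k].
Proof.
move=> [r [s [p [q [_ rp rq rE]]]] xr] x0; exists p, q; split=> // n k.
  by case: (rE n k).
have r0 : 0 <= (p n k)%:R / (q n k)%:R :> K by rewrite divr_ge0.
rewrite -real_ler_distl; last by rewrite rpredB // ger0_real.
have -> : (p n k)%:R / (q n k)%:R = `|r n k|.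
  case: (rE n k) => _ ->.
  by rewrite -mulrA normrM normrX normrN1 expr1n mul1r ger0_norm.
rewrite -[x n]ger0_norm //; apply: le_trans (ler_dist_dist _ _) _.
exact: xr.
Qed.

(** * Distances to a computable element and terms of computable sequences *)

Section Norms.
Variables (R : realType) (cplx : bool).
Variables (X : completeNormedModType (scalars R cplx)) (S : set (nat -> X)).
Hypothesis Scs : computability_structure S.

Lemma sum_indicator (c : scalars R cplx) (x : nat -> X) n j : (j <= n)%N ->
  \sum_(k < n.+1) (c * ((k : nat) == j)%:R) *: x k = c *: x j.
Proof.
move=> jn; have lt : (j < n.+1)%N by [].
rewrite (bigD1 (Ordinal lt)) //= eqxx mulr1 big1 ?addr0 // => i.
by rewrite -val_eqE /= => /negbTE ->; rewrite mulr0 scale0r.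
Qed.

(** The difference [x n - y] is a linear form of length [n.+1] whose coefficients are concentrated
    at [k = n]. *)
Lemma computable_dist (x : nat -> X) (y : X) : S x -> S (fun=> y) ->
  computable_real_seq (fun n => `|x n - y|).
Proof.
move=> Sx Sy; apply: (cs_norm Scs).
have rP : recb 2 (fun v => nth 0%N v 1 == nth 0%N v 0).
  by apply: recb_eq; exact: rec_nth.
have Dp := @double_seq_indicator R cplx (fun n k => k == n) 0 rP.
have Dm := @double_seq_indicator R cplx (fun n k => k == n) 1 rP.
have rl : recursive1 id by apply/recursive1P; exact: rec_nth.
have := cs_linear Scs Sx Sy Dp Dm rl; congr S; apply: funext => n.
by rewrite big_split /= !sum_indicator // expr0 expr1 scale1r scaleN1r.
Qed.

(** The constant sequence [x j] is a linear form in [x] of fixed length [j.+1] with coefficients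
    concentrated at [k = j]. *)
Lemma computable_elements_seq (x : nat -> X) j : S x ->
  computable_elements S (x j).
Proof.
move=> Sx; rewrite /computable_elements /=.
have rP : recb 2 (fun v => nth 0%N v 1 == j).
  by apply: recb_eq; [exact: rec_nth | exact: rec_const].
have Dp := @double_seq_indicator R cplx (fun n k => k == j) 0 rP.
have D0 : double_seq (@computable_scalar_seq R cplx) (fun n k => 0).
  have := @double_seq_indicator R cplx (fun n k => false) 0 (rec_const 2 0).
  by congr double_seq; apply: funext => n; apply: funext => k; rewrite mulr0.
have rl : recursive1 (fun=> j) by apply/recursive1P; exact: rec_const.
have := cs_linear Scs Sx Sx Dp D0 rl; congr S; apply: funext => n.
rewrite big_split /= sum_indicator // expr0 scale1r big1 ?addr0 // => i _.
by rewrite scale0r.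
Qed.

End Norms.

(** Clearing denominators makes the comparison decidable by a recursive predicate. *)
Lemma ltn_ratio (K : numFieldType) (p q c M : nat) : q != 0%N ->
  (c * q < p * 2 ^ M)%N = (c%:R * 2 ^- M < p%:R / q%:R :> K).
Proof.
move=> q0; rewrite ltr_pdivlMr ?ltr0n ?lt0n // mulrAC ltr_pdivrMr ?exprn_gt0 //.
by rewrite -natrX -!natrM ltr_nat.
Qed.

Lemma ltn_ratio_pow (K : numFieldType) (p q t n : nat) : q != 0%N ->
  ((p * 2 ^ t + q) * 2 ^ n < q * 2 ^ t)%N =
  (p%:R / q%:R + 2 ^- t < 2 ^- n :> K).
Proof.
move=> q0; have q0' : q%:R != 0 :> K by rewrite pnatr_eq0.
have t0 m : (2 : K) ^+ m != 0 by rewrite expf_neq0 // pnatr_eq0.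
have -> : p%:R / q%:R + 2 ^- t = (p * 2 ^ t + q)%:R / (q * 2 ^ t)%:R :> K.
  by rewrite natrD !natrM natrX; field; rewrite q0' t0.
rewrite ltr_pdivrMr; last by rewrite ltr0n muln_gt0 lt0n q0 expn_gt0.
by rewrite mulrC ltr_pdivlMr ?exprn_gt0 // -natrX -natrM ltr_nat.
Qed.

(** * Effective operators are continuous *)

Lemma pow2_le (K : numFieldType) m n : (m <= n)%N -> 2 ^- n <= 2 ^- m :> K.
Proof.
move=> mn; rewrite lef_pV2 ?posrE ?exprn_gt0 //.
by rewrite ler_weXn2l // ler1n.
Qed.

Lemma pow2_gt0 (K : numFieldType) n : 0 < 2 ^- n :> K.
Proof. by rewrite invr_gt0 exprn_gt0. Qed.

Lemma pow2_half (K : numFieldType) n : 2 ^- n.+1 + 2 ^- n.+1 = 2 ^- n :> K.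
Proof.
have t0 : (2 : K) ^+ n != 0 by rewrite expf_neq0 // pnatr_eq0.
by rewrite exprS; field.
Qed.

Lemma cvg_dist_pow2 (R : realType) (cplx : bool) (X : normedModType (scalars R cplx))
    (u : nat -> X) (x : X) : (forall n, `|u n - x| < 2 ^- n) -> u @ \oo --> x.
Proof.
move=> ux; apply/cvgrPdist_lt => eps /scalars_small_pow2[N HN].
near=> n; rewrite distrC; apply: lt_trans (ux n) _.
apply: le_lt_trans HN; apply: pow2_le; near: n; exact: nbhs_infty_ge.
Unshelve. all: by end_near.
Qed.

Section Operator.
Variables (R : realType) (cplx : bool).
Local Notation K := (scalars R cplx).
Variables (X : completeNormedModType K) (S : set (nat -> X)) (e a : nat -> X).
Variable phi : nat -> nat -> option nat.
Hypothesis Scs : computability_structure S.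
Hypothesis Se : effective_generating_seq S e.
Hypothesis Sa : computable_enum_rational_span S e a.
Hypothesis phiP : acceptable_numbering phi.

Local Notation Xk := (computable_elements S).

Lemma rational_span_dense (x : X) (eps : K) : 0 < eps ->
  exists j, `|a j - x| < eps.
Proof.
move=> eps0; have eps2 : 0 < eps / 2 by rewrite divr_gt0.
have [y [/= xy [d [c yE]]]] : ball x (eps / 2) `&` lin_span e !=set0.
  apply: (proj2 Se); last exact: ball_open.
  by exists x; apply: ballxx.
(* The tolerance for the [k]-th coefficient: after multiplication by [|e k|] each of the [d] terms
   errs by at most [eps / 2 / d.+1], in total at most [eps / 2]. The added ones keep the
   denominators positive. *)
pose w k : K := eps / 2 / d.+1%:R / (1 + `|e k|).
have e1 k : 0 < 1 + `|e k| by rewrite ltr_pwDl.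
have w0 k : 0 < w k by rewrite /w !divr_gt0.
have /choice[pq Hpq] k : exists pq : rat * rat,
    `|c k - (ratr pq.1 + im_unit R cplx * ratr pq.2)| < w k.
  exact: scalars_rational_approx.
pose z := \sum_(k < d) (ratr (pq k).1 + im_unit R cplx * ratr (pq k).2) *: e k.
have [j _ ajz] : range a z.
  rewrite (proj2 Sa); exists d, (fun k => (pq k).1), (fun k => (pq k).2).
  by [].
exists j; rewrite ajz.
apply: le_lt_trans (ler_distD y _ _) _.
rewrite [eps]splitr; apply: ler_ltD; last first.
  by rewrite distrC; move: xy; rewrite -ball_normE.
rewrite distrC yE /z -sumrB; apply: le_trans (ler_norm_sum _ _ _) _.
apply: (@le_trans _ _ (\sum_(k < d) (eps / 2 / d.+1%:R))).
  apply: ler_sum => k _; rewrite -scalerBl normrZ.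
  apply: (@le_trans _ _ (w k * (1 + `|e k|))); last first.
    by rewrite /w divfK // gt_eqF.
  apply: ler_pM => //; first exact: ltW.
  by rewrite lerDr.
rewrite sumr_const card_ord -[leLHS]mulr_natr mulrAC ler_pdivrMr ?ltr0n //.
by rewrite ler_wpM2l ?ler_nat // ltW.
Qed.

Lemma std_numberingI i f x : (forall n, phi i n = Some (f n)) ->
  (forall n, `|a (f n) - x| < 2 ^- n) -> std_numbering phi a i x.
Proof.
move=> phif fx; exists f; split=> //.
exact: cvg_dist_pow2.
Qed.

(** A strict inequality between computable reals is confirmed at some finite precision, so an
    unbounded search through precisions [t] and indices [j < t] succeeds. *)
Lemma search_close (x : X) (B : nat -> bool) : Xk x ->
  recb 1 (fun v => B (nth 0%N v 0)) ->
  (forall n, exists2 j, `|a j - x| < 2 ^- n & B j) ->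
  exists2 b : nat -> nat, recursive1 b &
    forall n, `|a (b n) - x| < 2 ^- n /\ B (b n).
Proof.
move=> Sx rB exj.
have [p [q [rp rq q0 pq]]] := computable_real_seq_nonneg
  (computable_dist Scs (proj1 Sa) Sx) (fun n => normr_ge0 _).
pose A n j t := ((p j t * 2 ^ t + q j t) * 2 ^ n < q j t * 2 ^ t)%N && B j.
have AP n j t : A n j t -> `|a j - x| < 2 ^- n /\ B j.
  move=> /andP[]; rewrite (ltn_ratio_pow K) // => lt Bj; split=> //.
  by apply: le_lt_trans lt; case/andP: (pq j t).
have rA : recb 3 (fun v => A (nth 0 v 2) (nth 0 v 0) (nth 0 v 1))%N.
  have rn i : rec 3 (fun v => nth 0 v i)%N by exact: rec_nth.
  have r2 f : rec 3 f -> rec 3 (fun v => 2 ^ f v)%N.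
    by apply: rec_exp; exact: rec_const.
  apply: recb_and; last exact: (rec_comp1 rB (rn 0%N)).
  have rq' : rec 3 (fun v => q (nth 0 v 0) (nth 0 v 1))%N by exact: rec_app2.
  apply: recb_ltn; apply: rec_mul => //; try exact: r2.
  apply: rec_add => //; apply: rec_mul; last exact: r2.
  exact: rec_app2.
pose P t n := (bmin (fun j => A n j t) t < t)%N.
have rP : recb 2 (fun v => P (nth 0 v 0) (nth 0 v 1))%N.
  exact: (recb_exists rA (rec_nth 2 0)).
have [v _|g rg gP] := rec_mu rP.
  set n := nth 0%N v 0; have [j jx Bj] := exj n.
  (* The gap below [2 ^- n] must absorb two errors [2 ^- t]: that of the approximation and the
     margin demanded by [A]. Precision [t0.+1] suffices for both. *)
  have [t0 Ht0] : exists t0, 2 ^- t0 < 2 ^- n - `|a j - x|.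
    by apply: scalars_small_pow2; rewrite subr_gt0.
  exists (maxn t0.+1 j.+1); apply/bmin_lt; exists j.
    by rewrite leq_max ltnSn orbT.
  rewrite -/n /= /A Bj andbT (ltn_ratio_pow K) //.
  set t := maxn _ _.
  have lt : 2 ^- t <= 2 ^- t0.+1 :> K by apply: pow2_le; rewrite leq_maxl.
  have /andP[le _] := pq j t; rewrite lerBlDr in le.
  apply: (@le_lt_trans _ _ (`|a j - x| + 2 ^- t + 2 ^- t)).
    by rewrite lerD2r.
  rewrite -addrA; apply: le_lt_trans (_ : `|a j - x| + 2 ^- t0 < _).
    by rewrite lerD2l -(pow2_half _ t0) lerD.
  by rewrite -ltrBrDl.
exists (fun n => bmin (fun j => A n j (g [:: n])) (g [:: n])).
  apply/recursive1P.
  apply: (@rec_bmin 1 (fun v => A (nth 0 v 1) (nth 0 v 0) (g [:: nth 0 v 1]))%N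
    (fun v => g [:: nth 0 v 0])%N); last exact: rec_comp1 (rec_nth _ _).
  apply: (rec_comp (gs := [:: nth 0 ^~ 0; fun v => g [:: nth 0 v 1]; nth 0 ^~ 1])%N rA).
  move=> [|[|[|]]] //= _; first [exact: rec_nth | exact: rec_comp1 (rec_nth _ _)].
move=> n; have := gP [:: n] erefl; rewrite /P /= => lt.
have [_ [E|[_ Ab]]] := bminP (fun j => A n j (g [:: n])) (g [:: n]).
  by move: lt; rewrite E ltnn.
exact: AP Ab.
Qed.

(** The s-m-n property turns uniformly recursive approximations into a recursive sequence of
    indices. *)
Lemma std_numbering_family (F : nat -> nat -> nat) (y : nat -> X) :
  recursive2 F -> (forall j n, `|a (F j n) - y j| < 2 ^- n) ->
  exists2 s, recursive1 s & forall j, std_numbering phi a (s j) (y j).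
Proof.
move=> rF Fy; have [s rs phis] := proj2 phiP (fun j n => Some (F j n)) rF.
by exists s => // j; apply: (std_numberingI (f := F j)) => // n; rewrite phis.
Qed.

Lemma std_numbering_onto (x : X) : Xk x -> exists2 f, recursive1 f &
  forall n, `|a (f n) - x| < 2 ^- n.
Proof.
move=> Sx; have [||b rb bx] := @search_close x xpredT Sx.
- exact: rec_const.
- by move=> n; have [j] := rational_span_dense x (pow2_gt0 _ n); exists j.
- by exists b => // n; case: (bx n).
Qed.

Variable T : X -> X.
Hypothesis Tlin : linear_operator_on Xk T.
Hypothesis Teff : effective_operator phi a T.

(** Run [psi] on the index of [y j], then evaluate the resulting program at [M]. Both computations
    halt because the indices lie in the domain of the numbering. *)
Lemma effective_operator_observe (s : nat -> nat) (y : nat -> X) (M : nat) :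
  recursive1 s -> (forall j, std_numbering phi a (s j) (y j)) ->
  exists2 i, recursive1 i & forall j, `|a (i j) - T (y j)| < 2 ^- M.
Proof.
move=> rs sy; have [psi ppsi psiT] := Teff.
have /choice[t Ht] j : exists t, psi (s j) = Some t /\ std_numbering phi a t (T (y j)).
  by have [t] := psiT _ _ (sy j); exists t.
have /choice[i Hi] j : exists i, phi (t j) M = Some i /\ `|a i - T (y j)| < 2 ^- M.
  by have [_ [f [phif _ fT]]] := Ht j; exists (f M).
exists i => [|j]; last by case: (Hi j).
apply/recursive1P.
have rt : rec 1 (fun v => t (nth 0 v 0))%N.
  apply: (rec_papp1 ppsi (g := fun v => s (nth 0 v 0))%N).
    by apply: rec_app1 => //; exact: rec_nth.
  by move=> v; case: (Ht (nth 0 v 0)%N).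
apply: (rec_papp2 (proj1 phiP) rt (rec_const 1 M)).
by move=> v; case: (Hi (nth 0 v 0)%N).
Qed.

Lemma effective_operator_continuous (x : X) (m : nat) : Xk x ->
  exists n, forall j, `|a j - x| < 2 ^- n -> `|T (a j) - T x| < 2 ^- m.
Proof.
move=> Sx; apply: contrapT => Hn.
have exj n : exists j, `|a j - x| < 2 ^- n /\ 2 ^- m <= `|T (a j) - T x|.
  apply: contrapT => Hj; apply: Hn; exists n => j jx.
  rewrite real_ltNge ?normr_real ?(gtr0_real (pow2_gt0 _ _)) //.
  by apply/negP => le; apply: Hj; exists j.
have STx : Xk (T x) by case: Tlin => H _ _; exact: H.
have [p [q [rp rq q0 pq]]] := computable_real_seq_nonneg
  (computable_dist Scs (proj1 Sa) STx) (fun n => normr_ge0 _).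
(* With [2 ^- m = 8 d] two tests with loss [2 d] on either side can be chained: distance at least
   [8 d] passes threshold 6, which guarantees more than [4 d], which passes threshold 2, which
   excludes distance 0. *)
pose M := m.+3; pose d : K := 2 ^- M.
have d0 : 0 < d by exact: pow2_gt0.
have dE : 2 ^- m = 8%:R * d.
  rewrite -(pow2_half _ m) -(pow2_half _ m.+1) -(pow2_half _ m.+2) -/M -/d.
  by ring.
pose far c i := (c * q i M < p i M * 2 ^ M)%N.
have rfar c i : recursive1 i -> recb 1 (fun v => far c (i (nth 0 v 0)))%N.
  move=> ri.
  have ri' : rec 1 (fun v => i (nth 0 v 0))%N by exact: rec_app1 (rec_nth _ _).
  apply: recb_ltn; apply: rec_mul; try exact: rec_const;
    exact: rec_app2 (rec_const _ _).
(* One [d] is lost by replacing [y] with [a i], another by the rational approximation of the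
   distance. *)
have farP c i y : `|a i - y| < d -> far c i -> (c%:R - 2) * d < `|y - T x|.
  rewrite /far (ltn_ratio K) // -/d => iy lt.
  have /andP[le _] := pq i M; rewrite -/d in le.
  have tri := ler_distD y (a i) (T x).
  rewrite mulrBl ltrBlDr.
  apply: lt_le_trans lt _; rewrite lerBlDr in le; apply: le_trans le _.
  have -> : 2 * d = d + d by rewrite mulr2n mulrDl mul1r.
  rewrite addrA lerD2r; apply: le_trans tri _.
  by rewrite [leLHS]addrC lerD2l ltW.
have farN c i y : `|a i - y| < d -> (c%:R + 2) * d <= `|y - T x| -> far c i.
  rewrite /far (ltn_ratio K) // -/d => iy le.
  have /andP[_ le'] := pq i M; rewrite -/d in le'.
  have tri := ler_distD (a i) y (T x); rewrite (distrC y (a i)) in tri.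
  have := le_trans le tri; rewrite mulrDl => le2.
  have lt2 : c%:R * d + 2 * d < d + ((p i M)%:R / (q i M)%:R + d).
    by apply: le_lt_trans le2 _; rewrite ltr_leD.
  rewrite -(ltrD2r (2 * d)); apply: lt_le_trans lt2 _.
  by have -> : d + ((p i M)%:R / (q i M)%:R + d) = (p i M)%:R / (q i M)%:R + 2 * d by ring.
have Fa : recursive2 (fun j _ => j) by apply/recursive2P; exact: rec_nth.
have [sa rsa saP] : exists2 s, recursive1 s & forall j, std_numbering phi a (s j) (a j).
  apply: std_numbering_family Fa _ => j n; by rewrite subrr normr0 pow2_gt0.
have [i ri iP] := effective_operator_observe M rsa saP.
have [|n|b rb bP] := @search_close x (fun j => far 6 (i j)) Sx.
- exact: rfar.
- have [j [jx jT]] := exj n; exists j => //.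
  apply: farN (iP j) _; rewrite -natrD -dE; exact: jT.
have bT n : 4%:R * d < `|T (a (b n)) - T x|.
  have [_ /(farP _ _ _ (iP _))] := bP n.
  by have -> : (6%:R - 2) * d = 4%:R * d by ring.
have [f rf fx] := std_numbering_onto Sx.
have [H rH undec] := undecidable_stage_predicate phiP.
(* The value [n.+1] means that no halting is seen up to stage [n] inclusive. *)
pose stop h n := bmin (H h) n.+1.
(* The shift in [f n.+1] leaves room for a later switch: if halting occurs at [n0 > n], then
   [f n.+1] and [b n0] both give elements within [2 ^- n.+1] of [x]. *)
pose F h n := if (stop h n < n.+1)%N then b (stop h n) else f n.+1.
have rF : recursive2 F.
  apply/recursive2P.
  have rS k : rec 2 (fun v => (nth 0 v k).+1)%N by apply: rec_succ; exact: rec_nth.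
  have rstop : rec 2 (fun v => stop (nth 0 v 0) (nth 0 v 1))%N.
    apply: (@rec_bmin 2 (fun v => H (nth 0 v 1) (nth 0 v 0))%N
      (fun v => (nth 0 v 1).+1)%N) => //.
    exact: (rec_comp2 rH (rec_nth 3 1) (rec_nth 3 0)).
  apply: rec_if; [exact: recb_ltn | exact: rec_app1 | exact: rec_app1].
have stopN h n : ~ (exists n, H h n) -> (stop h n < n.+1)%N = false.
  by move=> Hh; apply/bmin_lt => -[k _ Hk]; apply: Hh; exists k.
have /choice[y yP] h : exists y, (forall n, `|a (F h n) - y| < 2 ^- n) /\
    (y = x /\ ~ (exists n, H h n) \/ (exists n, H h n) /\ exists n, y = a (b n)).
  have [Hh|Hh] := pselect (exists n, H h n); last first.
    exists x; split; [move=> n|by left].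
    by rewrite /F stopN //; apply: lt_le_trans (fx n.+1) _; exact: pow2_le.
  pose n0 := ex_minn Hh; exists (a (b n0)); split; last by right; split=> //; exists n0.
  move=> n; have [Hn0 n0min] : H h n0 /\ forall k, H h k -> (n0 <= k)%N.
    by rewrite /n0; case: ex_minnP.
  have [le|lt] := leqP n0 n.
    have E : stop h n = n0.
      apply: bmin_eq => // k lt; apply/negP => /n0min; lia.
    by rewrite /F E ltnS le subrr normr0 pow2_gt0.
  have E : (stop h n < n.+1)%N = false.
    apply/bmin_lt => -[k ltk /n0min]; lia.
  rewrite /F E -pow2_half; apply: le_lt_trans (ler_distD x _ _) _.
  rewrite ltrD //; rewrite distrC; apply: lt_le_trans (proj1 (bP n0)) _.
  exact: pow2_le.
have [s rs sP] := std_numbering_family rF (fun h => proj1 (yP h)).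
have [i' ri' i'P] := effective_operator_observe M rs sP.
(* If [h] never halts then [y h] is [x], at image distance 0; otherwise the image distance exceeds
   [4 d]. Threshold 2 separates the two cases and would decide halting. *)
apply: (undec (fun h => far 2 (i' h))); first exact: rfar.
move=> h; have [_ [[yx Hh]|[Hh [n yn]]]] := yP h; split=> // Hf.
- have := farP _ _ _ (i'P h) Hf; rewrite yx subrr mul0r subrr normr0 ltxx.
  by [].
- apply: farN (i'P h) _; rewrite yn -natrD; exact: ltW.
Qed.

End Operator.

(** * Extension to the whole space *)

(** Additivity makes continuity at 0 uniform, so the image under [T] of the trace on [D] of the
    neighbourhoods of [x] is a Cauchy filter; [T' x] is its limit. As [delta] is independent of [x],
    the conclusion yields both convergence along sequences and continuity of [T']. *)
Lemma additive_dense_extension (K : numFieldType) (X : normedModType K)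
    (Y : completeNormedModType K) (D : set X) (T : X -> Y) :
  (forall x (eps : K), 0 < eps -> exists2 d, D d & `|d - x| < eps) ->
  (forall d d', D d -> D d' -> D (d - d') /\ T (d - d') = T d - T d') ->
  (forall eps : K, 0 < eps -> exists2 delta : K, 0 < delta &
     forall d, D d -> `|d| < delta -> `|T d| < eps) ->
  exists T' : X -> Y, forall eps : K, 0 < eps ->
    exists2 delta : K, 0 < delta &
      forall x d, D d -> `|d - x| < delta -> `|T d - T' x| < eps.
Proof.
move=> Ddense DB Tcont.
have Tunif (eps : K) : 0 < eps -> exists2 delta : K, 0 < delta &
    forall x d d', D d -> D d' -> `|d - x| < delta -> `|d' - x| < delta ->
      `|T d - T d'| < eps.
  move=> /Tcont[delta delta0 H]; exists (delta / 2); first by rewrite divr_gt0.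
  move=> x d d' Dd Dd' dx d'x; have [Ddd' <-] := DB _ _ Dd Dd'.
  apply: H => //; apply: le_lt_trans (ler_distD x _ _) _.
  by rewrite (distrC x) [delta]splitr ltrD.
pose F (x : X) := T @ within D (nbhs x).
have Fproper x : ProperFilter (F x).
  apply: fmap_proper_filter; apply: Build_ProperFilter_ex => A.
  rewrite /within /= => /nbhs_ballP[eps /= eps0 sub].
  have [d Dd dx] := Ddense x eps eps0; exists d; apply: sub => //.
  by rewrite -ball_normE /= distrC.
have Fball x (eps : K) (d : X) (delta : K) : 0 < delta ->
    (forall d', D d' -> `|d' - x| < delta -> `|T d - T d'| < eps) ->
    F x (ball (T d) eps).
  move=> delta0 H; rewrite /F /= /within /=; apply/nbhs_ballP; exists delta => //.
  by move=> d'; rewrite -!ball_normE /= distrC => d'x Dd'; exact: H.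
have Fcvg x : cvg (F x).
  apply/cauchy_cvgP; apply: cauchy_exP => eps /Tunif[delta delta0 H].
  have [d Dd dx] := Ddense x _ delta0; exists (T d).
  by apply: Fball delta0 _ => d' Dd'; apply: H.
exists (fun x => lim (F x)) => eps eps0.
have eps2 : 0 < eps / 2 by rewrite divr_gt0.
have [delta delta0 H] := Tunif _ eps2; exists delta => // x d Dd dx.
have Fd : F x (ball (T d) (eps / 2)).
  by apply: Fball delta0 _ => d' Dd'; apply: H.
have Fl : F x (ball (lim (F x)) (eps / 2)).
  by apply: (Fcvg x); apply: nbhsx_ballx.
have [y [/= dy ly]] := filter_ex (filterI Fd Fl).
rewrite -!ball_normE /= in dy ly.
apply: le_lt_trans (ler_distD y _ _) _.
by rewrite [eps]splitr ltrD // distrC.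
Qed.

(** * Linear combinations of computable elements with computable scalars *)

Section ComputableElements.
Variables (R : realType) (cplx : bool).
Local Notation K := (scalars R cplx).
Variables (X : completeNormedModType K) (S : set (nat -> X)).
Hypothesis Scs : computability_structure S.

Lemma computable_elements_linear (c d : K) (x y : X) :
  computable_scalar c -> computable_scalar d ->
  computable_elements S x -> computable_elements S y ->
  computable_elements S (c *: x + d *: y).
Proof.
move=> cc cd Sx Sy; rewrite /computable_elements /=.
have D (z : K) : computable_scalar z ->
    double_seq (@computable_scalar_seq R cplx) (fun _ _ => z).
  by move=> cz; exists (fun=> z).
have rl : recursive1 (fun=> 0%N) by apply/recursive1P; exact: rec_const.
have := cs_linear Scs Sx Sy (D _ cc) (D _ cd) rl.
by congr S; apply: funext => n; rewrite big_ord_recl big_ord0 addr0.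
Qed.

Lemma computable_scalar_sign b : computable_scalar ((-1) ^+ b : K).
Proof.
have := @computable_rational_scalar R cplx ((-1) ^+ b) 0.
by rewrite rmorph_sign rmorph0 mulr0 addr0.
Qed.

Lemma computable_scalar1 : computable_scalar (1 : K).
Proof. exact: (computable_scalar_sign 0). Qed.

Lemma computable_scalarN1 : computable_scalar (-1 : K).
Proof. exact: (computable_scalar_sign 1). Qed.

End ComputableElements.

Theorem theorem38 (R : realType) (cplx : bool)
    (X : completeNormedModType (scalars R cplx))
    (S : set (nat -> X)) (e a : nat -> X)
    (phi : nat -> nat -> option nat) (T : X -> X) :
  separable X ->
  computability_structure S ->
  effective_generating_seq S e ->
  computable_enum_rational_span S e a ->
  acceptable_numbering phi ->
  linear_operator_on (computable_elements S) T ->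
  effective_operator phi a T ->
  exists! T' : X -> X,
    [/\ linear T', continuous T' &
        forall x, computable_elements S x -> T' x = T x].
Proof.
move=> _ Scs Se Sa phiP Tlin Teff.
set Xk := computable_elements S; set K := scalars R cplx.
have [_ TD TZ] := Tlin; rewrite -/Xk in TD TZ.
have c1 := computable_scalar1 R cplx; have cN1 := computable_scalarN1 R cplx.
have Xka j : Xk (a j) by apply: computable_elements_seq => //; case: Sa.
have XkD x y : Xk x -> Xk y -> Xk (x + y).
  by move=> Sx Sy; have := computable_elements_linear Scs c1 c1 Sx Sy; rewrite !scale1r.
have XkB x y : Xk x -> Xk y -> Xk (x - y).
  move=> Sx Sy; have := computable_elements_linear Scs c1 cN1 Sx Sy.
  by rewrite scale1r scaleN1r.
have Xk0 : Xk 0 by rewrite -(subrr (a 0%N)); exact: XkB.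
have XkZ c x : computable_scalar c -> Xk x -> Xk (c *: x).
  move=> cc Sx; have := computable_elements_linear Scs cc c1 Sx Xk0.
  by rewrite scaler0 addr0.
have T0 : T 0 = 0 by apply: (addrI (T 0)); rewrite -TD // !addr0.
have TB x y : Xk x -> Xk y -> T (x - y) = T x - T y.
  move=> Sx Sy; rewrite -scaleN1r TD //; last exact: XkZ.
  by rewrite TZ // scaleN1r.
have Xkdense x (eps : K) : 0 < eps -> exists2 d, Xk d & `|d - x| < eps.
  by move=> /(rational_span_dense Se Sa x)[j jx]; exists (a j).
(* [effective_operator_continuous] controls [T] on the rational span only. A small [d] in [Xk] is
   therefore compared with some [a j] close to it: continuity at [d] bounds [T (a j) - T d], and
   continuity at 0 bounds [T (a j)]. *)
have Tcont (eps : K) : 0 < eps -> exists2 delta : K, 0 < delta &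
    forall d, Xk d -> `|d| < delta -> `|T d| < eps.
  move=> /scalars_small_pow2[m Hm].
  have [n Hn] := effective_operator_continuous Scs Se Sa phiP Tlin Teff m.+1 Xk0.
  exists (2 ^- n.+1); first exact: pow2_gt0.
  move=> d Sd dn; apply: lt_trans Hm.
  have [l Hl] := effective_operator_continuous Scs Se Sa phiP Tlin Teff m.+1 Sd.
  have [j Hj] := rational_span_dense Se Sa d (pow2_gt0 K (maxn l n.+1)).
  have jl : `|a j - d| < 2 ^- l.
    by apply: lt_le_trans Hj _; apply: pow2_le; exact: leq_maxl.
  have jn : `|a j - d| < 2 ^- n.+1.
    by apply: lt_le_trans Hj _; apply: pow2_le; exact: leq_maxr.
  have := Hn j; rewrite T0 !subr0 => Hnj.
  rewrite -(subr0 (T d)); apply: le_lt_trans (ler_distD (T (a j)) _ _) _.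
  rewrite subr0 -pow2_half ltrD //; first by rewrite distrC Hl.
  apply: Hnj; rewrite -(subr0 (a j)); apply: le_lt_trans (ler_distD d _ _) _.
  by rewrite subr0 -pow2_half ltrD.
have [|T' T'P] := additive_dense_extension Xkdense _ Tcont.
  by move=> d d' Sd Sd'; split; [exact: XkB | exact: TB].
have T'cvg (u : nat -> X) x : (forall n, Xk (u n)) -> u @ \oo --> x ->
    (T \o u) @ \oo --> T' x.
  move=> Su ux; apply/cvgrPdist_lt => eps /T'P[delta delta0 H].
  near=> n; rewrite distrC /=; apply: H => //.
  by near: n; move/cvgrPdistC_lt: ux; apply.
have dense_seq (x : X) : exists u : nat -> X, (forall n, Xk (u n)) /\ u @ \oo --> x.
  have /choice[u Hu] n : exists d, Xk d /\ `|d - x| < 2 ^- n.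
    by have [d] := Xkdense x _ (pow2_gt0 K n); exists d.
  exists u; split; first by move=> n; case: (Hu n).
  by apply: cvg_dist_pow2 => n; case: (Hu n).
exists T'; split.
  split.
  - move=> c x y.
    have [u [Su ux]] := dense_seq x; have [w [Sw wy]] := dense_seq y.
    (* [T] is homogeneous for computable scalars, so [c] is also approximated, by rational
       scalars. *)
    have /choice[q Hq] n : exists z : K, computable_scalar z /\ `|z - c| < 2 ^- n.
      have [pq Hpq] := scalars_rational_approx c (pow2_gt0 K n).
      exists (ratr pq.1 + im_unit R cplx * ratr pq.2).
      by rewrite distrC; split=> //; exact: computable_rational_scalar.
    have qc : q @ \oo --> c.
      by apply: (@cvg_dist_pow2 R cplx K^o) => n; case: (Hq n).
    have Sqx n : Xk (q n *: u n) by apply: XkZ => //; case: (Hq n).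
    have h1 : (T \o (fun n => q n *: u n + w n)) @ \oo --> T' (c *: x + y).
      apply: T'cvg; first by move=> n; exact: XkD.
      by apply: cvgD => //; exact: cvgZ.
    have h2 : (T \o (fun n => q n *: u n + w n)) @ \oo --> c *: T' x + T' y.
      rewrite (_ : _ \o _ = fun n => q n *: (T \o u) n + (T \o w) n).
        by apply: cvgD; [apply: cvgZ => //|]; exact: T'cvg.
      by apply: funext => n /=; rewrite TD // TZ //; case: (Hq n).
    exact: (cvg_unique _ h1 h2).
  - move=> x; apply/cvgrPdist_lt => eps eps0.
    have eps2 : 0 < eps / 2 by rewrite divr_gt0.
    have [delta delta0 H] := T'P _ eps2.
    have delta2 : 0 < delta / 2 by rewrite divr_gt0.
    (* A computable [d] near [x] is within [delta] of both [x] and every [y] near [x], so [T d] is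
       close to both values of [T']. *)
    have [d Sd dx] := Xkdense x _ delta2.
    have xy : \forall y \near x, `|x - y| < delta / 2.
      by apply/nbhs_ballP; exists (delta / 2) => // y; rewrite -ball_normE.
    apply: filterS xy => y xy.
    apply: le_lt_trans (ler_distD (T d) _ _) _.
    rewrite [eps]splitr ltrD //.
      rewrite distrC; apply: H => //; apply: lt_trans dx _.
      by rewrite ltr_pdivrMr // ltr_pMr // ltr1n.
    apply: H => //; apply: le_lt_trans (ler_distD x _ _) _.
    by rewrite [delta]splitr ltrD.
  - move=> x Sx.
    have h1 : (T \o (fun=> x)) n @[n --> \oo] --> T' x.
      by apply: T'cvg => //; exact: cvg_cst.
    have h2 : (T \o (fun=> x)) n @[n --> \oo] --> T x by exact: cvg_cst.
    exact: (cvg_unique _ h1 h2).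
(* Along a sequence of computable elements tending to [x], both extensions agree with [T], so their
   values at [x] are the same limit. *)
move=> T'' [_ T''cont T''T]; apply: funext => x.
have [u [Su ux]] := dense_seq x.
have h1 := T'cvg u x Su ux.
have h2 : (T \o u) @ \oo --> T'' x.
  rewrite (_ : T \o u = T'' \o u); last by apply: funext => n /=; rewrite T''T.
  by apply: cvg_comp ux _; exact: T''cont.
exact: (cvg_unique _ h1 h2).
Unshelve. all: by end_near.
Qed.
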